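(* Let $c>0$, $\epsilon>0$, let $y_n\in\mathbb R$ and let $\tilde{\mathbf x}_n$ be the random corrupted feature vectors in $\mathbb R^D$, $n=1,\dots,N$. For $\mathbf w\in\mathbb R^D$ write $\Delta_n(\mathbf w)=y_n-\mathbf w^\top\tilde{\mathbf x}_n$. Fix a current parameter $\bar{\mathbf w}\in\mathbb R^D$ with $\mathbb E_p[(\Delta_n(\bar{\mathbf w})-\epsilon)^2]>0$ and $\mathbb E_p[(\Delta_n(\bar{\mathbf w})+\epsilon)^2]>0$ for all $n$, and let $q(\boldsymbol\lambda,\boldsymbol\omega)=\prod_{n=1}^N q(\lambda_n)q(\omega_n)$ with $$q(\lambda_n)=\mathcal{GIG}\Big(\lambda_n;\tfrac12,1,c^2\mathbb E_p[(\Delta_n(\bar{\mathbf w})-\epsilon)^2]\Big),\qquad q(\omega_n)=\mathcal{GIG}\Big(\omega_n;\tfrac12,1,c^2\mathbb E_p[(\Delta_n(\bar{\mathbf w})+\epsilon)^2]\Big),$$ and $\gamma_n:=\mathbb E_q[\lambda_n^{-1}]$, $\delta_n:=\mathbb E_q[\omega_n^{-1}]$. Then the M-step, i.e. the minimization over $\mathbf w\in\mathbb R^D$ of $$\|\mathbf w\|_2^2+\frac{c^2}{2}\sum_{n=1}^N\mathbb E_p\big[\gamma_n(\Delta_n(\mathbf w)-\epsilon)^2+\delta_n(\Delta_n(\mathbf w)+\epsilon)^2\big],$$ is equivalent to (has the same minimizers as) the minimization over $\mathbf w\in\mathbb R^D$ of the $\ell_2$-regularized re-weighted quadratic loss $$\|\mathbf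 w\|_2^2+\frac{c^2}{2}\sum_{n=1}^N(\gamma_n+\delta_n)\,\mathbb E_p\big[(\mathbf w^\top\tilde{\mathbf x}_n-y_n^\epsilon)^2\big],\qquad y_n^\epsilon:=y_n+\frac{\delta_n-\gamma_n}{\delta_n+\gamma_n}\,\epsilon,$$ and the re-weights are given in closed form by $$\gamma_n=\frac{1}{c\sqrt{\mathbb E_p[(\Delta_n(\bar{\mathbf w})-\epsilon)^2]}},\qquad \delta_n=\frac{1}{c\sqrt{\mathbb E_p[(\Delta_n(\bar{\mathbf w})+\epsilon)^2]}}.$$
   Context: Data: $(\mathbf x_n,y_n)$, $n=1,\dots,N$, with $\mathbf x_n\in\mathbb R^D$ and real responses $y_n$. Each $\tilde{\mathbf x}_n$ is a random vector in $\mathbb R^D$, drawn from a corrupting distribution $p(\tilde{\mathbf x}_n\mid\mathbf x_n)=\prod_{d=1}^D p(\tilde x_{nd}\mid x_{nd})$ with independent coordinates, finite second moments and $\mathbb E_p[\tilde{\mathbf x}_n]=\mathbf x_n$. $\mathbb E_p$ denotes expectation under the corrupting distribution, $\mathbb E_q$ expectation under $q(\boldsymbol\lambda,\boldsymbol\omega)$. Any offset of the linear predictor is ignored (or absorbed into $\mathbf w$). $\mathcal{GIG}(x;p,a,b)$ denotes the generalized inverse Gaussian distribution on $(0,\infty)$ with density proportional to $x^{p-1}\exp\big(-\tfrac12(\tfrac bx+ax)\big)$. *)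

(* Defs.v *)
(* MathComp-Analysis, over an arbitrary [R : realType]. *)
From mathcomp Require Import all_boot all_order all_algebra.
From mathcomp Require Import all_classical all_reals all_analysis.

Set Implicit Arguments.
Unset Strict Implicit.
Unset Printing Implicit Defensive.

Import Order.TTheory GRing.Theory Num.Theory.
Import numFieldNormedType.Exports.

Local Open Scope classical_set_scope.
Local Open Scope ring_scope.

Definition dot (R : realType) (D : nat) (u v : 'cV[R]_D) : R :=
  \sum_(d < D) u d 0 * v d 0.

(* The canonical norm [`|w|] on matrices is the sup norm, hence this one. *)
Definition sqnorm2 (R : realType) (D : nat) (w : 'cV[R]_D) : R :=
  \sum_(d < D) w d 0 ^+ 2.

Definition minimizer (R : realType) (V : Type) (F : V -> \bar R) (w : V) : Prop :=
  forall v : V, (F w <= F v)%E.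

Definition mutually_independent (d : measure_display) (T : measurableType d)
    (R : realType) (P : probability T R) (I : finType) (X : I -> T -> R) : Prop :=
  forall (J : {set I}) (B : I -> set R), (forall i, measurable (B i)) ->
    P (\bigcap_(i in [set i | i \in J]) (X i @^-1` B i)) =
    (\prod_(i in J) P (X i @^-1` B i))%E.

Section generalized_inverse_gaussian.
Context {R : realType}.
Implicit Types p a b x : R.

Definition gig_kernel p a b x : R :=
  x `^ (p - 1) * expR (- (2^-1 * (b / x + a * x))).

Definition gig_pdf p a b : R -> R :=
  (fun x => gig_kernel p a b x /
     (\int[@lebesgue_measure R]_(u in `]0%R, +oo[) gig_kernel p a b u)%R)
  \_ `]0%R, +oo[.

Definition gig_prob p a b (A : set R) : \bar R :=
  (\int[@lebesgue_measure R]_(x in A) (gig_pdf p a b x)%:E)%E.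

Definition gig_distributed (d : measure_display) (T : measurableType d)
    (P : probability T R) (X : {RV P >-> R}) p a b : Prop :=
  forall A : set R, measurable A -> distribution P X A = gig_prob p a b A.

End generalized_inverse_gaussian.

(* The residual Delta_n(w), for a response [y] and a random vector [X]. *)
Definition residual (R : realType) (D : nat) (T : Type)
    (y : R) (X : T -> 'cV[R]_D) (w : 'cV[R]_D) (t : T) : R :=
  y - dot w (X t).

(* The variational factor q(lambda_n, omega_n : n < N) is carried by random
   variables on [Q]: independent, with generalized inverse Gaussian laws.  In
   the laws, [fine] is harmless, as the expectations are finite for [X n]
   with finite second moments. *)
Definition variational_law (R : realType) (N D : nat) (c eps : R)
    (d1 : measure_display) (T : measurableType d1) (P : probability T R)
    (y : 'I_N -> R) (X : 'I_N -> T -> 'cV[R]_D) (wbar : 'cV[R]_D)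
    (d2 : measure_display) (S : measurableType d2) (Q : probability S R)
    (lam om : 'I_N -> {RV Q >-> R}) : Prop :=
  [/\ mutually_independent Q (fun k : 'I_N + 'I_N =>
        match k with inl n => (lam n : S -> R) | inr n => (om n : S -> R) end),
      forall n, gig_distributed (lam n) (1 / 2) 1
        (c ^+ 2 * fine 'E_P[fun t => ((residual (y n) (X n) wbar t - eps) ^+ 2)%R])
    & forall n, gig_distributed (om n) (1 / 2) 1
        (c ^+ 2 * fine 'E_P[fun t => ((residual (y n) (X n) wbar t + eps) ^+ 2)%R])].

Definition Mstep_objective (R : realType) (N D : nat) (c eps : R)
    (d : measure_display) (T : measurableType d) (P : probability T R)
    (y : 'I_N -> R) (X : 'I_N -> T -> 'cV[R]_D) (gam del : 'I_N -> R)
    (w : 'cV[R]_D) : \bar R :=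
  ((sqnorm2 w)%:E + (c ^+ 2 / 2)%:E * \sum_(n < N)
     'E_P[fun t => (gam n * (residual (y n) (X n) w t - eps) ^+ 2
                    + del n * (residual (y n) (X n) w t + eps) ^+ 2)%R])%E.

Definition shifted_response (R : realType) (eps y gam del : R) : R :=
  y + (del - gam) / (del + gam) * eps.

Definition reweighted_objective (R : realType) (N D : nat) (c eps : R)
    (d : measure_display) (T : measurableType d) (P : probability T R)
    (y : 'I_N -> R) (X : 'I_N -> T -> 'cV[R]_D) (gam del : 'I_N -> R)
    (w : 'cV[R]_D) : \bar R :=
  ((sqnorm2 w)%:E + (c ^+ 2 / 2)%:E * \sum_(n < N) (gam n + del n)%:E *
     'E_P[fun t => ((dot w (X n t)
                     - shifted_response eps (y n) (gam n) (del n)) ^+ 2)%R])%E.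

(* Main.v *)
(* For the weights: the change of variables x -> (b / a) / x turns the kernel
   of GIG(p, a, b) into (b / a)^p times that of GIG(- p, a, b).  Dividing the
   kernel by x lowers p by 1, and 1/2 - 1 = - 1/2, so for p = 1/2 and a = 1 the
   numerator and the normalizing constant of E[1 / lambda] are the two sides of
   this identity: the ratio is b^(- 1/2), without computing any integral.
   For the M-step: completing the square in the residual shows that the two
   objectives differ by a finite constant. *)
Require Import Defs.
From mathcomp Require Import all_boot all_order all_algebra.
From mathcomp Require Import all_classical all_reals all_analysis.
From mathcomp Require Import measurable_realfun ring lra.

Set Implicit Arguments.
Unset Strict Implicit.
Unset Printing Implicit Defensive.

Import Order.TTheory GRing.Theory Num.Theory.
Import numFieldNormedType.Exports.

Local Open Scope classical_set_scope.
Local Open Scope ring_scope.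

(** * Measurability of inversion, and integration against a law with a density *)

Lemma measurable_inv (R : realType) : measurable_fun [set: R] (@GRing.inv R).
Proof.
(* This form reduces the claim to the measurability of [powR]; the factor [x] restores the sign, and
   at 0 both sides are 0. *)
rewrite (_ : @GRing.inv R = (fun x => x * (`|x| `^ (-1)) ^+ 2)); last first.
  apply/funext => x; rewrite powR_inv1// -normfV real_normK ?num_real//.
  have [->|x0] := eqVneq x 0; first by rewrite invr0 mul0r.
  by rewrite expr2 mulrA divff// mul1r.
apply: measurable_funM => //; apply: measurable_funX.
exact: (measurableT_comp (measurable_powR (-1))) (@normr_measurable _ _).
Qed.

(** [nu] is dominated by [mu], and its Radon-Nikodym derivative equals [p] almost everywhere because
    both have the same integral over every measurable set. *)
Lemma ge0_integral_density d (T : measurableType d) (R : realType)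
    (nu : {finite_measure set T -> \bar R})
    (mu : {sigma_finite_measure set T -> \bar R}) (p : T -> R) :
  measurable_fun [set: T] p -> (forall x, 0 <= p x) ->
  (forall A, measurable A -> nu A = (\int[mu]_(x in A) (p x)%:E)%E) ->
  forall f : T -> \bar R, measurable_fun [set: T] f ->
    (forall x, (0 <= f x)%E) ->
  (\int[nu]_x f x = \int[mu]_x (f x * (p x)%:E))%E.
Proof.
move=> mp p0 nuE f mf f0.
have mEp : measurable_fun [set: T] (EFin \o p) by exact/measurable_EFinP.
have numu : nu `<< mu.
  apply/null_content_dominatesP => A mA muA0.
  by rewrite nuE// null_set_integral//; exact: measurable_funTS.
rewrite -(Radon_Nikodym_SigmaFinite.change_of_variables numu)//.
have mRN := measurable_int _ (Radon_Nikodym_SigmaFinite.f_integrable numu).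
apply: ae_eq_integral => //; [exact: emeasurable_funM..|].
apply: ae_eqe_mul2l; apply: integral_ae_eq => //.
  exact: Radon_Nikodym_SigmaFinite.f_integrable.
by move=> A _ mA; rewrite -Radon_Nikodym_SigmaFinite.f_integral// -nuE.
Qed.

(** * The substitution x -> r / x on the positive half-line *)

Section substitution.
Context {R : realType}.
Local Notation mu := (@lebesgue_measure R).

(* [x |-> r / x] maps each of these intervals onto itself. *)
Lemma itvoy_bigcup_cc (r : R) : 0 < r ->
  `]0, +oo[%classic = \bigcup_n `[n.+1%:R^-1, r * n.+1%:R]%classic.
Proof.
move=> r0; apply/seteqP; split => [x|x [n _]] /=; last first.
  by rewrite !in_itv/= andbT => /andP[+ _]; apply: lt_le_trans.
rewrite in_itv/= andbT => x0.
have xr0 : 0 <= x / r by rewrite divr_ge0// ltW.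
have xV0 : 0 <= x^-1 by rewrite invr_ge0 ltW.
(* A bound for the sum exceeds both terms: [x^-1] gives the left endpoint condition, [x / r] the
   right one. *)
exists (Num.bound (x^-1 + x / r)) => //=; rewrite in_itv/=.
have := archi_boundP (addr_ge0 xV0 xr0).
set m := Num.bound _ => mP.
have mS : (m%:R <= m.+1%:R :> R) by rewrite ler_nat.
apply/andP; split.
  rewrite invf_ple ?posrE//; lra.
rewrite mulrC -ler_pdivrMr//; lra.
Qed.

Lemma derive1_divr (r x : R) : x != 0 ->
  (fun u => r / u)^`()%classic x = - (r / x ^+ 2).
Proof.
move=> x0; rewrite derive1E.
have : is_derive x 1 (fun u : R => r * (id u)^-1) (r *: (- x ^- 2 *: 1)).
  by apply: is_deriveZ; exact: is_deriveV.
by move=> H; rewrite derive_val /GRing.scale/= mulr1 mulrN.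
Qed.

Lemma divr_continuous (r x : R) : x != 0 -> {for x, continuous (fun u : R => r / u)}.
Proof. by move=> x0; apply: cvgM; [exact: cvg_cst|exact: cvgV]. Qed.

(** On each compact interval [J n] the map is a decreasing bijection, so substitution on a segment
    applies; monotone convergence along the increasing [J n] then gives the half-line, where both
    sides may be infinite. *)
Lemma ge0_integration_by_substitution_div (r : R) (G : R -> R) : 0 < r ->
  (forall x : R, 0 < x -> {for x, continuous G}) ->
  (forall x : R, 0 < x -> 0 <= G x) ->
  (\int[mu]_(x in `]0%R, +oo[) (G x)%:E =
   \int[mu]_(x in `]0%R, +oo[) (G (r / x) * (r / x ^+ 2))%:E)%E.
Proof.
move=> r0 cG G0.
pose J n : set R := `[n.+1%:R^-1, r * n.+1%:R]%classic.
have J0 n x : J n x -> 0 < x.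
  by rewrite /J/= in_itv/= => /andP[+ _]; apply: lt_le_trans.
have Jm n : measurable (J n) by exact: measurable_itv.
have ndJ : nondecreasing_seq J.
  move=> m n mn; rewrite subsetEset /J => x/=; rewrite !in_itv/= => /andP[h1 h2].
  rewrite (le_trans _ h1) ?lef_pV2 ?posrE ?ler_nat//= (le_trans h2)//.
  by rewrite ler_pM2l// ler_nat.
have cH x : 0 < x ->
    {for x, continuous (fun u : R => G (r / u) * (r / u ^+ 2))}.
  move=> x0.
  have cGr : {for x, continuous (G \o (fun u : R => r / u))}.
    apply: continuous_comp; first by apply: divr_continuous; rewrite gt_eqF.
    by apply: cG; rewrite divr_gt0.
  apply: cvgM; first exact: cGr.
  apply: cvgM; first exact: cvg_cst.
  by apply: cvgV; [rewrite expf_neq0 ?gt_eqF|exact: exprn_continuous].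
have mJ (F : R -> R) : (forall x : R, 0 < x -> {for x, continuous F}) ->
    forall n, measurable_fun (J n) (fun x => (F x)%:E).
  move=> cF n; apply/measurable_EFinP; apply: subspace_continuous_measurable_fun => //.
  by apply: continuous_in_subspaceT => x /[!inE] /J0; exact: cF.
rewrite (itvoy_bigcup_cc r0).
have JH0 n x : J n x -> (0 <= (G (r / x) * (r / x ^+ 2))%:E)%E.
  move=> /J0 x0; rewrite lee_fin mulr_ge0 ?G0 ?divr_gt0//.
  by rewrite divr_ge0 ?exprn_ge0// ltW.
have JG0 n x : J n x -> (0 <= (G x)%:E)%E by move=> /J0 x0; rewrite lee_fin G0.
have cvgJ (F : R -> R) (cF : forall x : R, 0 < x -> {for x, continuous F})
    (F0 : forall n x, J n x -> (0 <= (F x)%:E)%E) :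
    (\int[mu]_(x in \bigcup_n J n) (F x)%:E =
     limn (fun n => \int[mu]_(x in J n) (F x)%:E))%E.
  apply/esym/cvg_lim => //.
  by apply: ge0_nondecreasing_set_cvg_integral => //; exact: mJ.
rewrite !cvgJ//.
apply: congr_lim; apply/funext => n.
(* For small [r] the first intervals [J n] are empty, and both integrals are 0. *)
have [ab|ba] := leP n.+1%:R^-1 (r * n.+1%:R); last first.
  by rewrite /J set_itv_ge ?integral_set0// bnd_simp -ltNge.
have := @integration_by_substitution_decreasing R (fun u => r / u) G _ _ ab.
(* The map exchanges the two endpoints, so the image of [J n] is [J n] itself. *)
rewrite invrK invfM mulrA divff ?gt_eqF// mul1r.
have cD x : 0 < x -> {for x, continuous (fun u : R => r / u)^`()%classic}.
  move=> x0; have cr : {for x, continuous (fun u : R => - (r / u ^+ 2))}.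
    apply: cvgN; apply: cvgM; first exact: cvg_cst.
    by apply: cvgV; [rewrite expf_neq0 ?gt_eqF|exact: exprn_continuous].
  suff : (fun u : R => r / u)^`()%classic u @[u --> x] --> - (r / x ^+ 2).
    by rewrite -derive1_divr ?gt_eqF.
  (* The closed form of the derivative is available at nonzero points only, hence on a neighborhood
     of [x]. *)
  apply: cvg_trans cr; apply: near_eq_cvg.
  near=> u; rewrite derive1_divr// gt_eqF//.
  near: u; exact: lt_nbhsr.
have b0 : 0 < r * n.+1%:R by rewrite mulr_gt0.
have a0 : 0 < n.+1%:R^-1 :> R by rewrite invr_gt0.
move=> ->.
- apply: eq_integral => x; rewrite inE => /J0 x0; congr EFin.
  by rewrite /= !fctE/= derive1_divr ?gt_eqF// opprK.
- move=> x z xJ zJ zx; have /J0 x0 := xJ; have /J0 z0 := zJ.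
  by rewrite ltr_pM2l// ltf_pV2.
- move=> x; rewrite in_itv/= => /andP[ax _]; apply: cD.
  exact: lt_trans ax.
- by apply: (cvgP _ (cvg_at_right_filter (cD _ _))).
- by apply: (cvgP _ (cvg_at_left_filter (cD _ _))).
- split.
  + move=> x; rewrite in_itv/= => /andP[ax _].
    apply: derivableM => //; apply: derivableV => //.
    by rewrite gt_eqF// (lt_trans _ ax).
  + apply: cvg_at_right_filter; apply: divr_continuous; by rewrite gt_eqF.
  + apply: cvg_at_left_filter; apply: divr_continuous; by rewrite gt_eqF.
- by apply: continuous_in_subspaceT => x /[!inE] /J0; exact: cG.
Unshelve. all: by end_near. Qed.

End substitution.

(** * Generalized inverse Gaussian kernels and the mean of the inverse *)

Section gig.
Context {R : realType}.
Local Notation mu := (@lebesgue_measure R).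
Implicit Types p a b x : R.

Lemma gig_kernel_ge0 p a b x : 0 <= gig_kernel p a b x.
Proof. by rewrite mulr_ge0 ?powR_ge0 ?expR_ge0. Qed.

Lemma measurable_gig_kernel p a b : measurable_fun [set: R] (gig_kernel p a b).
Proof.
apply: measurable_funM; first exact: measurable_powR.
apply: measurableT_comp => //; apply: measurableT_comp => //.
apply: measurable_funM => //; apply: measurable_funD; apply: measurable_funM => //.
exact: measurable_inv.
Qed.

Lemma gig_kernel_continuous p a b x : 0 < x ->
  {for x, continuous (gig_kernel p a b)}.
Proof.
move=> x0.
have cpow : {for x, continuous (fun u : R => u `^ (p - 1))}.
  have /derivable1_diffP/differentiable_continuous // :
    derivable (fun u : R => u `^ (p - 1)) x 1.
  by apply: derivable_powR; rewrite in_itv/= x0.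
apply: cvgM; first exact: cpow.
apply: (@cvg_comp _ _ _ _ expR); last exact: continuous_expR.
apply: cvgN; apply: cvgM; first exact: cvg_cst.
apply: cvgD; apply: cvgM; [exact: cvg_cst| |exact: cvg_cst|exact: cvg_id].
by apply: cvgV; rewrite ?gt_eqF.
Qed.

Lemma gig_kernel_div p a b x : 0 < x ->
  gig_kernel p a b x / x = gig_kernel (p - 1) a b x.
Proof.
move=> x0; rewrite /gig_kernel mulrAC; congr (_ * _).
by rewrite [in RHS]powRB ?powRr1 ?(ltW x0)// (gt_eqF x0) implybT.
Qed.

(** The exponent [b / x + a * x] is invariant under x -> r / x with r = b / a, while power and
    Jacobian combine to (r / x)^p / x = r^p x^(- p - 1). *)
Lemma gig_kernel_inversion p a b x : 0 < a -> 0 < b -> 0 < x ->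
  gig_kernel p a b (b / a / x) * (b / a / x ^+ 2) =
  (b / a) `^ p * gig_kernel (- p) a b x.
Proof.
move=> a0 b0 x0.
have r0 : 0 < b / a by rewrite divr_gt0.
have xr0 : 0 < b / a / x by rewrite divr_gt0.
rewrite /gig_kernel.
have -> : b / (b / a / x) + a * (b / a / x) = b / x + a * x.
  by field; rewrite !gt_eqF.
rewrite mulrAC [RHS]mulrA; congr (_ * _).
have -> : b / a / x ^+ 2 = (b / a / x) / x by rewrite expr2 invfM mulrA.
rewrite powRB ?(gt_eqF xr0) ?implybT// powRr1 ?(ltW xr0)//.
rewrite [in RHS]powRB ?(gt_eqF x0) ?implybT// powRr1 ?(ltW x0)//.
rewrite [LHS]mulrA divfK ?(lt0r_neq0 xr0)// powRM ?invr_ge0 ?ltW//.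
by rewrite -[x^-1]powR_inv1 ?ltW// -powRrM mulN1r mulrA.
Qed.

(** Kept in [\bar R], so that no convergence of the kernel integrals has to be known beforehand. *)
Lemma integral_gig_kernel_opp p a b : 0 < a -> 0 < b ->
  (\int[mu]_(x in `]0%R, +oo[) (gig_kernel p a b x)%:E =
   ((b / a) `^ p)%:E * \int[mu]_(x in `]0%R, +oo[) (gig_kernel (- p) a b x)%:E)%E.
Proof.
move=> a0 b0; have r0 : 0 < b / a by rewrite divr_gt0.
rewrite (ge0_integration_by_substitution_div r0); first last.
- by move=> x _; exact: gig_kernel_ge0.
- exact: gig_kernel_continuous.
rewrite -ge0_integralZl//; first last.
- by rewrite lee_fin powR_ge0.
- by move=> x _; rewrite lee_fin gig_kernel_ge0.
- by apply/measurable_EFinP; apply: measurable_funTS; exact: measurable_gig_kernel.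
apply: eq_integral => x; rewrite inE/= in_itv/= andbT => x0.
by rewrite gig_kernel_inversion// EFinM.
Qed.

Lemma gig_pdf_ge0 p a b x : 0 <= gig_pdf p a b x.
Proof.
rewrite /gig_pdf patchE; case: ifP => // _.
by rewrite divr_ge0 ?gig_kernel_ge0// Rintegral_ge0// => u _; exact: gig_kernel_ge0.
Qed.

Lemma measurable_gig_pdf p a b : measurable_fun [set: R] (gig_pdf p a b).
Proof.
apply/(measurable_restrictT _ _).1 => //; apply: measurable_funM => //.
by apply: measurable_funTS; exact: measurable_gig_kernel.
Qed.

Context d (S : measurableType d) (Q : probability S R) (X : {RV Q >-> R}).

(* [Rintegral] is 0 on a divergent integral and division by 0 gives 0, so a zero
   normalizing constant would make the law vanish: finiteness of the mass comes
   from the existence of [X]. *)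
Lemma gig_mass_neq0 p a b : gig_distributed X p a b ->
  (\int[mu]_(u in `]0%R, +oo[) gig_kernel p a b u)%R != 0.
Proof.
move=> /(_ _ measurableT) XE; apply/eqP => Z0; move: XE.
rewrite probability_setT /gig_prob integral0_eq; last first.
  by move=> x _; rewrite /gig_pdf patchE Z0; case: ifP => //; rewrite invr0 mulr0.
by move=> /eqP; rewrite onee_eq0.
Qed.

(** The density vanishes off []0, +oo[]. Positivity is what lets [X^-1] be replaced by its absolute
    value under the expectation. *)
Lemma gig_ae_gt0 p a b : gig_distributed X p a b -> {ae Q, forall s, (0 < X s)%R}.
Proof.
move=> XE; have m0 : measurable (`]-oo, 0%R]%classic : set R) by [].
exists (X @^-1` `]-oo, 0%R]%classic); split.
- exact: measurable_funPTI.
- rewrite -[LHS]/(distribution Q X _) XE// /gig_prob integral0_eq// => x.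
  rewrite /= in_itv/= => x0; rewrite /gig_pdf patchE memNset//=.
  by rewrite in_itv/= andbT; apply/negP; rewrite -leNgt.
- by move=> s /= /negP; rewrite -leNgt in_itv.
Qed.

Lemma expectation_gig_inv p a b : gig_distributed X p a b ->
  ('E_Q[fun s => ((X s)^-1)%R] =
   \int[mu]_(x in `]0%R, +oo[) (gig_kernel (p - 1) a b x)%:E *
   ((\int[mu]_(u in `]0%R, +oo[) gig_kernel p a b u)^-1)%R%:E)%E.
Proof.
move=> XE; rewrite unlock.
have mabs : measurable_fun [set: R] (fun x : R => (`|x^-1|)%:E).
  apply/measurable_EFinP; apply: measurableT_comp => //; exact: measurable_inv.
(* The absolute value makes the integrand nonnegative everywhere, so that transfer to the law and to
   its density needs no integrability. *)
transitivity (\int[Q]_s (`|(X s)^-1|)%:E)%E.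
  apply: ae_eq_integral => //.
  - apply/measurable_EFinP; exact: (measurableT_comp (@measurable_inv R)).
  - exact: (measurableT_comp mabs).
  - apply: filterS (gig_ae_gt0 XE) => s s0 _.
    by rewrite ger0_norm// invr_ge0 ltW.
(* The Lebesgue measure lives on [measurableTypeR R], whose display is not the
   one of the codomain of [X]. *)
have mX : @measurable_fun _ _ S (measurableTypeR R) [set: S] X.
  exact: (measurable_funPT X).
pose X' : {mfun S >-> measurableTypeR R} :=
  @mfun_Sub _ _ S (measurableTypeR R) X (mem_set mX).
rewrite -(@ge0_integral_distribution _ _ _ (measurableTypeR R) _ Q X'
  (fun x => (`|x^-1|)%:E))//.
rewrite (@ge0_integral_density _ (measurableTypeR R) _ (distribution Q X') mu _
  (measurable_gig_pdf p a b) (gig_pdf_ge0 p a b) XE)//.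
set Z := (\int[mu]_(u in _) _)%R.
rewrite -ge0_integralZr//; first last.
- rewrite lee_fin invr_ge0 Rintegral_ge0// => u _; exact: gig_kernel_ge0.
- by move=> x _; rewrite lee_fin gig_kernel_ge0.
- by apply/measurable_EFinP; apply: measurable_funTS; exact: measurable_gig_kernel.
(* Both integrals now run over the whole line and are compared pointwise; off []0, +oo[] both
   integrands are 0. *)
rewrite [RHS]integral_mkcond; apply: eq_integral => x _.
rewrite /gig_pdf !patchE; case: ifPn => [|_]; last by rewrite mule0.
rewrite inE/= in_itv/= andbT => x0.
rewrite -gig_kernel_div// ger0_norm ?invr_ge0 ?ltW// -!EFinM.
by congr EFin; rewrite -/Z; ring.
Qed.

Lemma expectation_gig_half_inv b : 0 < b -> gig_distributed X (1 / 2) 1 b ->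
  ('E_Q[fun s => ((X s)^-1)%R] = ((Num.sqrt b)^-1)%:E)%E.
Proof.
move=> b0 XE; rewrite (expectation_gig_inv XE).
have := gig_mass_neq0 XE; rewrite /Rintegral.
rewrite (integral_gig_kernel_opp _ ltr01 b0) divr1 div1r powR12_sqrt ?ltW//.
have -> : 2^-1 - 1 = - 2^-1 :> R by lra.
(* The numerator is [I], and the normalizing constant is [fine] of [Num.sqrt b] times [I]. *)
set I := (\int[mu]_(x in _) _)%E => Z0.
have I0 : (0 <= I)%E.
  by apply: integral_ge0 => x _; rewrite lee_fin gig_kernel_ge0.
have s0 : 0 < Num.sqrt b by rewrite sqrtr_gt0.
(* A finite [I] is nonzero and cancels; an infinite one would give the normalizing constant the
   default value 0, against [Z0]. *)
case: I I0 Z0 => [i| |]//= _.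
  rewrite mulf_eq0 negb_or => /andP[_ i0].
  by rewrite -EFinM invfM mulrCA divff// mulr1.
by rewrite mulry gtr0_sg// mul1e eqxx.
Qed.

End gig.

(** * Square-integrable residuals and completion of the square *)

Section square_integrable.
Context {R : realType} d (T : measurableType d) (P : probability T R).

Lemma expectation_sqr_lty_Lfun2 (f : T -> R) : measurable_fun [set: T] f ->
  ('E_P[fun t => (f t ^+ 2)%R] < +oo)%E -> f \in Lfun P 2%:E.
Proof.
rewrite unlock => mf f2; rewrite inE; apply/andP; split; rewrite inE//=.
rewrite /finite_norm unlock poweR_lty//=.
under eq_integral => t _ do rewrite powR_mulrn// -normrX ger0_norm ?sqr_ge0//.
exact: f2.
Qed.

Lemma residual_Lfun2 D (y : R) (X : T -> 'cV[R]_D) (w : 'cV[R]_D) :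
  (forall i, (fun t => X t i 0) \in Lfun P 2%:E) ->
  residual y X w \in Lfun P 2%:E.
Proof.
move=> hX; have le12 : (1 <= 2%:E :> \bar R)%E by rewrite lee_fin ler1n.
rewrite (_ : residual y X w =
    cst y - \sum_(i < D) (fun t => w i 0 * X t i 0)); last first.
  by apply/funext => t; rewrite /residual /dot !fctE fct_sumE.
rewrite rpredB ?Lfun_cst ?rpred_sum// => i _.
rewrite (_ : (fun _ => _) = (w i 0 \o* (fun t => X t i 0))).
  by apply: Lfun_scale => //; rewrite ler1n.
by apply/funext => t; rewrite mulrC.
Qed.

Lemma expectation_sqr_fin_num (f : T -> R) :
  f \in Lfun P 2%:E -> 'E_P[fun t => (f t ^+ 2)%R]%E \is a fin_num.
Proof.
move=> /Lfun2_integrable_sqr fi.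
by rewrite expectation_fin_num//; exact/Lfun1_integrable.
Qed.

(** With r the residual, g (r - eps)^2 + h (r + eps)^2 = (g + h) (r + (h - g) / (g + h) eps)^2 + 4 g
    h / (g + h) eps^2. All terms are nonnegative, so the integral splits even when it is
    infinite. *)
Lemma expectation_weighted_eps_loss (y eps g h : R) (D : nat)
    (X : T -> 'cV[R]_D) (w : 'cV[R]_D) :
  0 < g -> 0 < h -> measurable_fun [set: T] (residual y X w) ->
  ('E_P[fun t => (g * (residual y X w t - eps) ^+ 2
                  + h * (residual y X w t + eps) ^+ 2)%R] =
   (g + h)%:E * 'E_P[fun t => ((dot w (X t)
                                - shifted_response eps y g h) ^+ 2)%R] +
   (4 * g * h / (g + h) * eps ^+ 2)%:E)%E.
Proof.
move=> g0 h0 mr; rewrite unlock.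
have gh0 : 0 < g + h by rewrite addr_gt0.
have md : measurable_fun [set: T]
    (fun t => (dot w (X t) - shifted_response eps y g h) ^+ 2).
  (* The linear predictor is recovered as [y] minus the residual, whose measurability is given. *)
  rewrite (_ : (fun _ => _) = (fun t =>
      (y - residual y X w t - shifted_response eps y g h) ^+ 2)).
    by apply: measurable_funX; apply: measurable_funB => //; exact: measurable_funB.
  by apply/funext => t; rewrite /residual subKr.
rewrite -ge0_integralZl//; first last.
- by rewrite lee_fin ltW.
- by move=> t _; rewrite lee_fin sqr_ge0.
- exact/measurable_EFinP.
set K := 4 * g * h / (g + h) * eps ^+ 2.
have K0 : 0 <= K.
  by rewrite mulr_ge0 ?sqr_ge0// divr_ge0 ?(ltW gh0)// !mulr_ge0// ltW.
(* The total mass is 1, so the constant is its own integral. *)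
rewrite -[X in (_ + X)%E](_ : (\int[P]_t K%:E = K%:E)%E); last first.
  by have := expectation_cst P K; rewrite unlock.
rewrite -ge0_integralD//; first last.
- by apply/measurable_EFinP; exact: measurable_funM.
- by move=> t _; rewrite -EFinM lee_fin mulr_ge0 ?sqr_ge0// ltW.
apply: eq_integral => t _; rewrite -EFinM -EFinD; congr EFin.
by rewrite /K /residual /shifted_response; field; rewrite gt_eqF.
Qed.

End square_integrable.

(** * Minimizers under a finite shift, and assembly of the theorem *)

Lemma minimizerDr (R : realType) (V : Type) (F G : V -> \bar R) (k : R) (w : V) :
  (forall v, F v = G v + k%:E)%E -> minimizer F w <-> minimizer G w.
Proof.
move=> FG; split=> wmin v; have := wmin v.
  (* A finite constant cancels in an inequality of [\bar R], even at infinite values of [G]. *)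
  by rewrite !FG leeD2rE.
by rewrite !FG leeD2rE.
Qed.

Theorem lemma2 (R : realType) (N D : nat) (c eps : R)
    (x : 'I_N -> 'cV[R]_D) (y : 'I_N -> R)
    (d1 : measure_display) (T : measurableType d1) (P : probability T R)
    (X : 'I_N -> T -> 'cV[R]_D) (wbar : 'cV[R]_D)
    (d2 : measure_display) (S : measurableType d2) (Q : probability S R)
    (lam om : 'I_N -> {RV Q >-> R})
    (hc : 0 < c) (heps : 0 < eps)
    (hX_meas : forall n d, measurable_fun [set: T] (fun t => X n t d 0))
    (hX_indep : forall n, mutually_independent P (fun d t => X n t d 0))
    (hX_mom2 : forall n d, ('E_P[fun t => ((X n t d 0) ^+ 2)%R] < +oo)%E)
    (hX_mean : forall n d, ('E_P[fun t => (X n t d 0)%R] = (x n d 0)%:E)%E)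
    (hbar_minus : forall n,
       (0 < 'E_P[fun t => ((residual (y n) (X n) wbar t - eps) ^+ 2)%R])%E)
    (hbar_plus : forall n,
       (0 < 'E_P[fun t => ((residual (y n) (X n) wbar t + eps) ^+ 2)%R])%E)
    (hq : variational_law c eps P y X wbar lam om) :
  let gam := fun n => fine 'E_Q[fun s => ((lam n s)^-1)%R] in
  let del := fun n => fine 'E_Q[fun s => ((om n s)^-1)%R] in
  [/\ forall w : 'cV[R]_D,
        minimizer (Mstep_objective c eps P y X gam del) w <->
        minimizer (reweighted_objective c eps P y X gam del) w,
      forall n, ('E_Q[fun s => ((lam n s)^-1)%R] =
        (1 / (c * Num.sqrt
           (fine 'E_P[fun t => ((residual (y n) (X n) wbar t - eps) ^+ 2)%R])))%:E)%E
    & forall n, ('E_Q[fun s => ((om n s)^-1)%R] =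
        (1 / (c * Num.sqrt
           (fine 'E_P[fun t => ((residual (y n) (X n) wbar t + eps) ^+ 2)%R])))%:E)%E].
Proof.
move=> gam del; have le12 : (1 <= 2%:E :> \bar R)%E by rewrite lee_fin ler1n.
have hX2 n i : (fun t => X n t i 0) \in Lfun P 2%:E.
  exact: expectation_sqr_lty_Lfun2.
have hres n w : residual (y n) (X n) w \in Lfun P 2%:E by exact: residual_Lfun2.
have mres n w : measurable_fun [set: T] (residual (y n) (X n) w).
  by have := hres n w; rewrite inE => /andP[/[!inE]].
have fin_minus n : 'E_P[fun t => ((residual (y n) (X n) wbar t - eps) ^+ 2)%R]%E
    \is a fin_num.
  by apply: expectation_sqr_fin_num; apply: rpredB => //; exact: Lfun_cst.
have fin_plus n : 'E_P[fun t => ((residual (y n) (X n) wbar t + eps) ^+ 2)%R]%E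
    \is a fin_num.
  by apply: expectation_sqr_fin_num; apply: rpredD => //; exact: Lfun_cst.
have [_ hlam hom] := hq.
(* Shared by [lam] and [om]. Finiteness of [e] rules out the default [fine +oo = 0], so the GIG
   parameter is positive. *)
have weight (Y : {RV Q >-> R}) (e : \bar R) : (0 < e)%E -> e \is a fin_num ->
    gig_distributed Y (1 / 2) 1 (c ^+ 2 * fine e) ->
    ('E_Q[fun s => ((Y s)^-1)%R] = (1 / (c * Num.sqrt (fine e)))%:E)%E /\
    0 < 1 / (c * Num.sqrt (fine e)).
  move=> e0 efin Ylaw.
  have fe0 : 0 < fine e by rewrite fine_gt0// e0 ltey_eq efin.
  split; last by rewrite divr_gt0// mulr_gt0// sqrtr_gt0.
  rewrite (expectation_gig_half_inv _ Ylaw) ?mulr_gt0 ?exprn_gt0//.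
  by rewrite sqrtrM ?sqr_ge0// sqrtr_sqr gtr0_norm// div1r.
have gamE n := weight _ _ (hbar_minus n) (fin_minus n) (hlam n).
have delE n := weight _ _ (hbar_plus n) (fin_plus n) (hom n).
split=> [w|n|n]; [|exact: (gamE n).1|exact: (delE n).1].
have gam0 n : 0 < gam n by rewrite /gam (gamE n).1/= (gamE n).2.
have del0 n : 0 < del n by rewrite /del (delE n).1/= (delE n).2.
(* The shift collects the remainders of the completed squares; it does not depend on the
   minimization variable. *)
apply: (@minimizerDr _ _ _ _ (c ^+ 2 / 2 *
  \sum_(n < N) 4 * gam n * del n / (gam n + del n) * eps ^+ 2)) => v.
rewrite /Mstep_objective /reweighted_objective.
under eq_bigr do rewrite expectation_weighted_eps_loss//.
(* Distributivity in [\bar R] rests on the nonnegativity of both sums, hence on that of the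
   weights. *)
rewrite big_split/= sumEFin ge0_muleDr.
- by rewrite EFinM addeA.
- apply: sume_ge0 => n _; rewrite mule_ge0 ?lee_fin ?addr_ge0 ?(ltW (gam0 _)) ?(ltW (del0 _))//.
  by apply: expectation_ge0 => t; exact: sqr_ge0.
- rewrite lee_fin; apply: sumr_ge0 => n _; rewrite mulr_ge0 ?sqr_ge0//.
  by rewrite divr_ge0 ?addr_ge0 ?mulr_ge0// ltW.
Qed.
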